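(* Let $t\in\mathbb R\setminus\{0\}$. The space $\mathbf H_2^t$, endowed with either of the real symmetric bilinear forms $$[f,g]_{\circledast}=\sum_{n=0}^\infty [g_n,f_n]_{\circledast},\qquad [f,g]_{[*]}=\sum_{n=0}^\infty [g_n,f_n]_{[*]},$$ where $f(q_t)=\sum_{n=0}^\infty q_t^nf_n$ and $g(q_t)=\sum_{n=0}^\infty q_t^ng_n$ belong to $\mathbf H_2^t$, is a Krein space. In the case of the form $[\cdot,\cdot]_{\circledast}$ it is a Hilbert space when $t<0$.
   Context: For $t\in\mathbb R\setminus\{0\}$, $\mathbb H_t$ is the real algebra (matrix addition and multiplication) of matrices $q_t=\begin{pmatrix}a&tb\\ \overline b&\overline a\end{pmatrix}$, $a,b\in\mathbb C$. Put $q_t^{\circledast}=\begin{pmatrix}\overline a&-tb\\ -\overline b&a\end{pmatrix}$ and $q_t^{[*]}=\begin{pmatrix}a&t\overline b\\ b&\overline a\end{pmatrix}$, and define the real symmetric forms $[p,q]_{\circledast}={\rm Tr}\,(q^{\circledast}p)$ and $[p,q]_{[*]}={\rm Tr}\,(q^{[*]}p)$ on $\mathbb H_t$. The scaled Euclidean norm is $\|q_t\|_E=\sqrt{|a|^2+|t|\,|b|^2}$. $\mathbf H_2^t$ is the real vector space of power series $f(q_t)=\sum_{n=0}^\infty q_t^n\alpha_n$ with $\alpha_n\in\mathbb H_t$ and $\sum_{n=0}^\infty\|\alpha_n\|_E^2<\infty$ (elements are determined by their coefficient sequences). A (real) Krein space is a real vector space $\mathcal V$ with a symmetric bilinear form $[\cdot,\cdot]$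 that admits a decomposition $\mathcal V=\mathcal V_++\mathcal V_-$ which is direct and orthogonal for $[\cdot,\cdot]$, such that $(\mathcal V_+,[\cdot,\cdot])$ and $(\mathcal V_-,-[\cdot,\cdot])$ are Hilbert spaces. *)

(* Defs.v *)
From HB Require Import structures.
From mathcomp Require Import all_boot all_order all_algebra.
From mathcomp Require Import complex.
From mathcomp Require Import boolp classical_sets functions reals topology.
From mathcomp Require Import normedtype sequences.
From mathcomp Require Import ring lra.

Set Implicit Arguments.
Unset Strict Implicit.
Unset Printing Implicit Defensive.

Import Order.TTheory GRing.Theory Num.Theory.
Import numFieldNormedType.Exports.
Import ComplexField.Normc.

Local Open Scope ring_scope.
Local Open Scope complex_scope.
Local Open Scope classical_set_scope.

Section Algebra.
Context {R : realType}.
Implicit Types (t r : R) (a b : R[i]).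

Lemma conjcD (x y : R[i]) : conjc (x + y) = conjc x + conjc y.
Proof. exact: rmorphD. Qed.

Lemma conjcM (x y : R[i]) : conjc (x * y) = conjc x * conjc y.
Proof. exact: rmorphM. Qed.

Definition mx2 a b c d : 'M[R[i]]_2 :=
  \matrix_(i < 2, j < 2)
    if i == 0 then (if j == 0 then a else b) else (if j == 0 then c else d).

Definition qmx t a b : 'M[R[i]]_2 := mx2 a (t%:C * b) (conjc b) (conjc a).

Definition Ht_pred t : {pred 'M[R[i]]_2} :=
  [pred A | `[< exists a b, A = qmx t a b >]].

Lemma qmxP t a b : qmx t a b \in Ht_pred t.
Proof. by apply/asboolP; exists a; exists b. Qed.

Lemma qmxB t a b c d : qmx t a b - qmx t c d = qmx t (a - c) (b - d).
Proof.
apply/matrixP => i j; rewrite !mxE.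
by case: ifP => _; case: ifP => _; rewrite ?mulrBr ?rmorphB.
Qed.

Lemma qmxZ t r a b : r%:C *: qmx t a b = qmx t (r%:C * a) (r%:C * b).
Proof.
have rE (z : R[i]) : r%:C * conjc z = conjc (r%:C * z).
  by rewrite rmorphM /= oppr0.
apply/matrixP => i j; rewrite !mxE.
by case: ifP => _; case: ifP => _; rewrite // mulrCA.
Qed.

Lemma qmxM t a b c d : qmx t a b *m qmx t c d =
  qmx t (a * c + t%:C * (b * conjc d)) (a * d + b * conjc c).
Proof.
have tE : conjc (t%:C : R[i]) = t%:C by exact: conjc_real.
apply/matrixP => i j; rewrite !mxE big_ord_recl big_ord1 !mxE /=.
case: i j => [[|[|i]] //= ?] [[|[|j]] //= ?];
  rewrite ?(conjcD, conjcM, conjcK, tE); ring.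
Qed.

Lemma qmx1 t : qmx t 1 0 = 1.
Proof.
apply/matrixP => i j; rewrite !mxE.
by case: i j => [[|[|i]] //= ?] [[|[|j]] //= ?];
  rewrite /= ?mulr0 ?oppr0 ?(rmorph1, rmorph0).
Qed.

Lemma Ht_subring t : subring_closed (Ht_pred t).
Proof.
split=> [|A B|A B]; first by rewrite -(qmx1 t) qmxP.
- move=> /asboolP[a [b ->]] /asboolP[c [d ->]].
  by rewrite qmxB; exact: qmxP.
- move=> /asboolP[a [b ->]] /asboolP[c [d ->]].
  by rewrite -[_ * _]/(_ *m _) qmxM; exact: qmxP.
Qed.

HB.instance Definition _ t :=
  GRing.isSubringClosed.Build _ (Ht_pred t) (Ht_subring t).

Record Ht t := HtSub { Ht_mx :> 'M[R[i]]_2; Ht_mxP : Ht_mx \in Ht_pred t }.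

HB.instance Definition _ t := [isSub for @Ht_mx t].
HB.instance Definition _ t := [Choice of Ht t by <:].
HB.instance Definition _ t := [SubChoice_isSubNzRing of Ht t by <:].

Lemma Ht_scale_subproof t r (q : Ht t) : r%:C *: Ht_mx q \in Ht_pred t.
Proof.
by have /asboolP[a [b ->]] := Ht_mxP q; rewrite qmxZ qmxP.
Qed.

Definition Ht_scale t r (q : Ht t) : Ht t := HtSub (Ht_scale_subproof r q).

Lemma Ht_scaleA t r s (q : Ht t) :
  Ht_scale r (Ht_scale s q) = Ht_scale (r * s) q.
Proof. by apply: val_inj; rewrite /= scalerA -rmorphM. Qed.

Lemma Ht_scale1 t : left_id 1 (@Ht_scale t).
Proof. by move=> q; apply: val_inj; rewrite /= rmorph1 scale1r. Qed.

Lemma Ht_scaleDr t : right_distributive (@Ht_scale t) +%R.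
Proof. by move=> r p q; apply: val_inj; rewrite /= scalerDr. Qed.

Lemma Ht_scaleDl t (q : Ht t) :
  {morph (@Ht_scale t)^~ q : r s / r + s}.
Proof.
by move=> r s; apply: val_inj; rewrite /= rmorphD scalerDl.
Qed.

HB.instance Definition _ t := GRing.Zmodule_isLmodule.Build R (Ht t)
  (@Ht_scaleA t) (@Ht_scale1 t) (@Ht_scaleDr t) (@Ht_scaleDl t).

Lemma Ht_scaleAl t r (p q : Ht t) : r *: (p * q) = (r *: p) * q.
Proof. by apply: val_inj; rewrite /= -scalerAl. Qed.

HB.instance Definition _ t :=
  GRing.Lmodule_isLalgebra.Build R (Ht t) (@Ht_scaleAl t).

Lemma Ht_scaleAr t r (p q : Ht t) : r *: (p * q) = p * (r *: q).
Proof. by apply: val_inj; rewrite /= -scalerAr. Qed.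

HB.instance Definition _ t :=
  GRing.Lalgebra_isAlgebra.Build R (Ht t) (@Ht_scaleAr t).

Definition mkHt t a b : Ht t := HtSub (qmxP t a b).

(* The entries a and b are read off the first column (a, conj b). *)
Definition Ht_a t (q : Ht t) : R[i] := Ht_mx q 0 0.
Definition Ht_b t (q : Ht t) : R[i] := conjc (Ht_mx q 1 0).

Lemma HtE t (q : Ht t) : q = mkHt t (Ht_a q) (Ht_b q).
Proof.
apply: val_inj => /=; rewrite /Ht_a /Ht_b.
have /asboolP[a [b ->]] := Ht_mxP q; rewrite !mxE /=.
by case: b => x y; rewrite /= opprK.
Qed.

(* Written out entrywise in Ht_circE and Ht_starE below. *)
Definition Ht_circ t (q : Ht t) : Ht t := mkHt t (conjc (Ht_a q)) (- Ht_b q).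

Definition Ht_star t (q : Ht t) : Ht t := mkHt t (Ht_a q) (conjc (Ht_b q)).

Lemma Ht_circE t (q : Ht t) : Ht_circ q =
  mx2 (conjc (Ht_a q)) (- (t%:C * Ht_b q)) (- conjc (Ht_b q)) (Ht_a q)
    :> 'M_2.
Proof.
rewrite /= /qmx mulrN rmorphN.
by congr mx2; case: (Ht_a q) => x y; rewrite /= opprK.
Qed.

Lemma Ht_starE t (q : Ht t) : Ht_star q =
  mx2 (Ht_a q) (t%:C * conjc (Ht_b q)) (Ht_b q) (conjc (Ht_a q)) :> 'M_2.
Proof.
by rewrite /= /qmx; congr mx2; case: (Ht_b q) => x y; rewrite /= opprK.
Qed.

Lemma Ht_mxtrace_real t (q : Ht t) : (complex.Re (\tr q))%:C = \tr q.
Proof.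
rewrite /mxtrace big_ord_recl big_ord1.
have /asboolP[a [b ->]] := Ht_mxP q; rewrite !mxE /=.
by case: a => x y; apply/eqP; rewrite eq_complex /= subrr !eqxx.
Qed.

(* By Ht_mxtrace_real, taking real parts only changes the type. *)
Definition form_circ t (p q : Ht t) : R :=
  complex.Re (\tr (Ht_circ q * p : Ht t)).
Definition form_star t (p q : Ht t) : R :=
  complex.Re (\tr (Ht_star q * p : Ht t)).

Definition normE t (q : Ht t) : R :=
  Num.sqrt (normc (Ht_a q) ^+ 2 + `|t| * normc (Ht_b q) ^+ 2).

(* A power series \sum_n q^n f_n is represented by its coefficients. *)
Definition H2_pred t : {pred nat -> Ht t} :=
  [pred f : nat -> Ht t | `[< cvgn [series normE (f n) ^+ 2]_n >]].
Arguments H2_pred t f : clear implicits.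

Lemma normc_sqr (z : R[i]) :
  normc z ^+ 2 = complex.Re z ^+ 2 + complex.Im z ^+ 2.
Proof. by case: z => x y; rewrite sqr_sqrtr // addr_ge0 // sqr_ge0. Qed.

Lemma normE_sqr t (q : Ht t) : normE q ^+ 2 =
  complex.Re (Ht_a q) ^+ 2 + complex.Im (Ht_a q) ^+ 2
  + `|t| * (complex.Re (Ht_b q) ^+ 2 + complex.Im (Ht_b q) ^+ 2).
Proof.
rewrite /normE !normc_sqr sqr_sqrtr // addr_ge0 ?mulr_ge0 //;
  by rewrite addr_ge0 ?sqr_ge0.
Qed.

Lemma sqr_lin_le (r x y : R) :
  (r * x + y) ^+ 2 <= 2 * r ^+ 2 * x ^+ 2 + 2 * y ^+ 2.
Proof.
by have := sqr_ge0 (r * x - y); lra.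
Qed.

Lemma normE_lin t r (p q : Ht t) :
  normE (r *: p + q) ^+ 2 <= 2 * r ^+ 2 * normE p ^+ 2 + 2 * normE q ^+ 2.
Proof.
have lina : Ht_a (r *: p + q) = r%:C * Ht_a p + Ht_a q.
  by rewrite /Ht_a /= !mxE.
have linb : Ht_b (r *: p + q) = r%:C * Ht_b p + Ht_b q.
  by rewrite /Ht_b /= !mxE conjcD conjcM conjc_real.
rewrite !normE_sqr lina linb.
case: (Ht_a p) (Ht_b p) (Ht_a q) (Ht_b q) => [x1 x2] [x3 x4] [y1 y2] [y3 y4] /=.
rewrite !mul0r subr0 !addr0.
have h1 := sqr_lin_le r x1 y1.
have h2 := sqr_lin_le r x2 y2.
have h3 := ler_wpM2l (normr_ge0 t) (sqr_lin_le r x3 y3).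
have h4 := ler_wpM2l (normr_ge0 t) (sqr_lin_le r x4 y4).
lra.
Qed.

Lemma H2_submod t : submod_closed (H2_pred t).
Proof.
split.
  apply/asboolP.
  have -> : [series normE ((0 : nat -> Ht t) n) ^+ 2]_n = cst 0.
    apply/funext => n; rewrite /series /= big1 // => i _.
    by rewrite normE_sqr /Ht_a /Ht_b !mxE /= oppr0 expr0n /= addr0 mulr0 addr0.
  exact: is_cvg_cst.
move=> r f g /asboolP cf /asboolP cg; apply/asboolP.
apply: (@series_le_cvg _ _
  (fun n => 2 * r ^+ 2 * normE (f n) ^+ 2 + 2 * normE (g n) ^+ 2)).
- by move=> n; exact: sqr_ge0.
- move=> n; apply: addr_ge0; apply: mulr_ge0; rewrite ?sqr_ge0 ?ler0n //.
  by apply: mulr_ge0; rewrite ?sqr_ge0 ?ler0n.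
- by move=> n; exact: normE_lin.
- by apply: is_cvg_seriesD; apply: is_cvg_seriesZ.
Qed.

HB.instance Definition _ t :=
  GRing.isSubmodClosed.Build R (nat -> Ht t) (H2_pred t) (H2_submod t).

Record H2 t := H2Sub {
  H2_coef :> nat -> Ht t;
  H2_coefP : H2_coef \in H2_pred t
}.

HB.instance Definition _ t := [isSub for @H2_coef t].
HB.instance Definition _ t := [Choice of H2 t by <:].
HB.instance Definition _ t := [SubChoice_isSubZmodule of H2 t by <:].
HB.instance Definition _ t := [SubZmodule_isSubLmodule of H2 t by <:].

Definition H2_form_circ t (f g : H2 t) : R :=
  limn [series form_circ (g n) (f n)]_n.
Definition H2_form_star t (f g : H2 t) : R :=
  limn [series form_star (g n) (f n)]_n.

End Algebra.

Section Krein.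
Context {R : realType} {V : lmodType R}.
Implicit Types (B : V -> V -> R) (W : {pred V}).

Definition symmetric_bilinear B : Prop :=
  bilinear_for *%R *%R B /\ (forall x y, B x y = B y x).

Definition form_norm B (x : V) : R := Num.sqrt (B x x).

Definition form_complete B W : Prop :=
  forall u : nat -> V, (forall n, u n \in W) ->
    (forall e : R, 0 < e -> exists N : nat, forall m n : nat,
       (N <= m)%N -> (N <= n)%N -> form_norm B (u m - u n) < e) ->
    exists2 l : V, l \in W & form_norm B (u n - l) @[n --> \oo] --> (0 : R).

(* The subspace W with the restriction of B is a Hilbert space. *)
Definition hilbert_on B W : Prop :=
  [/\ submod_closed W,
      symmetric_bilinear B,
      (forall x, x \in W -> x != 0 -> 0 < B x x) &
      form_complete B W].

Definition hilbert_space B : Prop := hilbert_on B predT.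

Definition krein_space B : Prop :=
  symmetric_bilinear B /\
  exists Vp Vm : {pred V},
    [/\ (forall x, exists xp xm, [/\ xp \in Vp, xm \in Vm & x = xp + xm]),
        (forall x, x \in Vp -> x \in Vm -> x = 0),
        (forall x y, x \in Vp -> y \in Vm -> B x y = 0),
        hilbert_on B Vp &
        hilbert_on (fun x y => - B x y) Vm].

End Krein.

(* Main.v *)
(* In the four real coordinates (Re a, Im a, Re b, Im b) the squared norm is the
   positive diagonal form with weights (1, 1, |t|, |t|), and each of the two
   forms is twice that form with some of the weights negated.  Hence the
   sequences whose coordinates vanish at the negated (resp. the other) indices
   give a fundamental decomposition: on each summand the form is +-2 times the
   l^2 inner product, and a coordinatewise closed subspace of l^2 is complete
   (take coordinatewise limits and bound the partial sums of the norm).  For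
   the first form and t < 0 no weight is negated. *)
Require Import Defs.
From mathcomp Require Import all_boot all_order all_algebra.
From mathcomp Require Import complex boolp classical_sets functions reals.
From mathcomp Require Import topology normedtype sequences realfun.
From mathcomp Require Import ring lra.

Import Order.TTheory GRing.Theory Num.Theory.
Import numFieldNormedType.Exports.

Local Open Scope ring_scope.
Local Open Scope classical_set_scope.

(** * Real coordinates on [Ht t] and diagonal forms in them *)

Section RealCoordinates.
Context {R : realType} {t : R}.
Implicit Types (i : 'I_4) (s : pred 'I_4) (p q : Ht t) (r : R).

Definition Ht_coord i q : R :=
  nth 0 [:: complex.Re (Ht_a q); complex.Im (Ht_a q);
            complex.Re (Ht_b q); complex.Im (Ht_b q)] i.

Definition Ht_of_coord (x : 'I_4 -> R) : Ht t :=
  mkHt t (Complex (x (inord 0)) (x (inord 1)))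
         (Complex (x (inord 2)) (x (inord 3))).

(** The absolute value keeps the weights nonnegative; the sign of [t] goes into the pattern [s] of
    [sform]. *)
Definition weight i : R := if (i < 2)%N then 1 else `|t|.

Definition sform s p q : R :=
  \sum_i 2 * (-1) ^+ s i * weight i * (Ht_coord i p * Ht_coord i q).

Lemma Ht_coord_lin i r p q : Ht_coord i (r *: p + q) =
  r * Ht_coord i p + Ht_coord i q.
Proof.
have lina : Ht_a (r *: p + q) = real_complex R r * Ht_a p + Ht_a q.
  by rewrite /Ht_a /= !mxE.
have linb : Ht_b (r *: p + q) = real_complex R r * Ht_b p + Ht_b q.
  by rewrite /Ht_b /= !mxE conjcD conjcM conjc_real.
rewrite /Ht_coord lina linb.
case: (Ht_a p) (Ht_b p) (Ht_a q) (Ht_b q) => [x1 x2] [x3 x4] [y1 y2] [y3 y4].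
by case: i => [[|[|[|[|i]]]] //= ?]; rewrite mul0r ?subr0 ?addr0.
Qed.

Lemma Ht_coord0 i : Ht_coord i 0 = 0.
Proof.
by have := Ht_coord_lin i (-1) 0 0; rewrite scaler0 addr0 mulN1r addNr.
Qed.

Lemma Ht_coordB i p q : Ht_coord i (p - q) = Ht_coord i p - Ht_coord i q.
Proof. by rewrite addrC -scaleN1r Ht_coord_lin mulN1r addrC. Qed.

Lemma Ht_of_coordK x i : Ht_coord i (Ht_of_coord x) = x i.
Proof.
rewrite /Ht_coord /Ht_a /Ht_b /= !mxE /= opprK.
by case: i => [[|[|[|[|i]]]] // ?] /=;
  congr x; apply: val_inj; rewrite /= inordK.
Qed.

Lemma Ht_coord_inj p q : (forall i, Ht_coord i p = Ht_coord i q) -> p = q.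
Proof.
move=> pq; rewrite (HtE p) (HtE q).
have := (pq (inord 0), pq (inord 1), pq (inord 2), pq (inord 3)).
rewrite /Ht_coord !inordK //=.
by case: (Ht_a p) (Ht_b p) (Ht_a q) (Ht_b q)
  => [? ?] [? ?] [? ?] [? ?] /= [[[-> ->] ->] ->].
Qed.

Lemma weight_ge0 i : 0 <= weight i.
Proof. by rewrite /weight; case: ifP. Qed.

Lemma weight_gt0 i : t != 0 -> 0 < weight i.
Proof. by rewrite /weight; case: ifP; rewrite ?normr_gt0. Qed.

Lemma normE_coord q : normE q ^+ 2 = \sum_i weight i * Ht_coord i q ^+ 2.
Proof.
rewrite normE_sqr !big_ord_recl big_ord0 /weight /Ht_coord /=; ring.
Qed.

Lemma sformC s p q : sform s p q = sform s q p.
Proof. by apply: eq_bigr => i _; rewrite [Ht_coord i p * _]mulrC. Qed.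

Lemma sform_lin s r p q u :
  sform s u (r *: p + q) = r * sform s u p + sform s u q.
Proof.
rewrite /sform mulr_sumr -big_split /=; apply: eq_bigr => i _.
by rewrite Ht_coord_lin; ring.
Qed.

Lemma sformN s p q : - sform s p q = sform (predC s) p q.
Proof.
rewrite /sform -sumrN; apply: eq_bigr => i _ /=.
by case: (s i); rewrite /=; ring.
Qed.

(* Young's inequality [2 |x y| <= x^2 + y^2] in each coordinate. *)
Lemma sform_le s p q : `|sform s p q| <= normE p ^+ 2 + normE q ^+ 2.
Proof.
rewrite !normE_coord -big_split /=; apply: le_trans (ler_norm_sum _ _ _) _.
apply: ler_sum => i _; rewrite !normrM normr_sign mulr1 normr_nat.
rewrite (ger0_norm (weight_ge0 i)).
have := mulr_ge0 (weight_ge0 i) (sqr_ge0 (`|Ht_coord i p| - `|Ht_coord i q|)).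
by rewrite -(real_normK (num_real (Ht_coord i p)))
  -(real_normK (num_real (Ht_coord i q))); lra.
Qed.

(** The two diagonal entries of a product in [Ht t] are conjugate, so the trace is twice the real
    part of the first one. *)
Lemma Re_trace_mkHtM (a b c d : R[i]) :
  complex.Re (\tr (mkHt t a b * mkHt t c d : Ht t)) =
  2 * (complex.Re (a * c) + t * complex.Re (b * conjc d)).
Proof.
have -> : Ht_mx (mkHt t a b * mkHt t c d) =
  qmx t (a * c + real_complex R t * (b * conjc d)) (a * d + b * conjc c).
  exact: qmxM.
rewrite /mxtrace !big_ord_recl big_ord0 !mxE /=.
by case: a b c d => [x1 x2] [x3 x4] [y1 y2] [y3 y4] /=; ring.
Qed.

(** Half the trace is [Re (conj a_q * a_p) - t * Re (b_q * conj b_p)]: the coordinates of [b] carry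
    the sign of [-t]. *)
Lemma form_circE p q : form_circ p q =
  sform (fun i => (0 < t) && (1 < i)%N) p q.
Proof.
rewrite /form_circ {1}(HtE p) Re_trace_mkHtM.
rewrite /sform !big_ord_recl !big_ord0 /weight /Ht_coord /=.
case: (Ht_a p) (Ht_b p) (Ht_a q) (Ht_b q) => [x1 x2] [x3 x4] [y1 y2] [y3 y4] /=.
by case: ltrgt0P => /= [_|_|->]; ring.
Qed.

(** Without conjugation, [Re (a_q * a_p)] negates the product of imaginary parts. The term in [b] is
    [t] times such a difference, so the sign of [t] decides which of [Re b], [Im b] is negated. *)
Lemma form_starE p q : form_star p q =
  sform (fun i => (val i == 1)%N || (val i == if 0 < t then 3 else 2)) p q.
Proof.
rewrite /form_star {1}(HtE p) Re_trace_mkHtM.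
rewrite /sform !big_ord_recl !big_ord0 /weight /Ht_coord /=.
case: (Ht_a p) (Ht_b p) (Ht_a q) (Ht_b q) => [x1 x2] [x3 x4] [y1 y2] [y3 y4] /=.
by case: ltrgt0P => /= [_|_|->]; ring.
Qed.
End RealCoordinates.

(** * Square-summable sequences and the forms on them *)

Section HardySpace.
Context {R : realType} {t : R}.
Implicit Types (i : 'I_4) (s : pred 'I_4) (f g h : H2 t) (r e : R).

Definition H2_sform s f g : R := limn [series sform s (f n) (g n)]_n.

Definition H2_sqnorm f : R := limn [series normE (f n) ^+ 2]_n.

(** Here [s] marks the coordinates to be killed; with the pattern of [H2_sform s] this removes
    exactly the negated ones. *)
Definition vanishing_on s : {pred H2 t} :=
  [pred f : H2 t | `[< forall n i, s i -> Ht_coord i (f n) = 0 >]].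

Lemma H2_linE r f g n : (r *: f + g) n = r *: f n + g n.
Proof. by []. Qed.

Lemma H2_subE f g n : (f - g) n = f n - g n.
Proof. by []. Qed.

Lemma H2_zeroE n : (0 : H2 t) n = 0.
Proof. by []. Qed.

Lemma H2_eqP f g : (forall n, f n = g n) -> f = g.
Proof. by move=> fg; apply: val_inj; apply/funext. Qed.

Lemma H2_cvg f : cvgn [series normE (f n) ^+ 2]_n.
Proof. exact/asboolP/H2_coefP. Qed.

Lemma nondecreasing_series_sqnorm (u : nat -> Ht t) :
  nondecreasing_seq [series normE (u n) ^+ 2]_n.
Proof. by apply: nondecreasing_series => n _ _; exact: sqr_ge0. Qed.

Lemma series_le_sqnorm f n : [series normE (f k) ^+ 2]_k n <= H2_sqnorm f.
Proof.
exact: nondecreasing_cvgn_le (nondecreasing_series_sqnorm f) (H2_cvg f) n.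
Qed.

Lemma normE_le_sqnorm f n : normE (f n) ^+ 2 <= H2_sqnorm f.
Proof.
apply: le_trans (series_le_sqnorm f n.+1).
rewrite seriesEord /= big_ord_recr /= lerDr.
by apply: sumr_ge0 => k _; exact: sqr_ge0.
Qed.

Lemma H2_sqnorm_ge0 f : 0 <= H2_sqnorm f.
Proof. exact: le_trans (sqr_ge0 _) (normE_le_sqnorm f 0). Qed.

Lemma bounded_series_H2 (u : nat -> Ht t) (M : R) :
  (forall n, [series normE (u k) ^+ 2]_k n <= M) -> u \in @H2_pred R t.
Proof.
move=> uM; apply/asboolP.
apply: nondecreasing_is_cvgn (nondecreasing_series_sqnorm u) _.
by exists M => _ [n _ <-].
Qed.

(** Absolute convergence, by comparison through [sform_le]; hence the [limn] in [H2_sform] is a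
    genuine sum and not a default value. *)
Lemma cvg_sform s f g : cvgn [series sform s (f n) (g n)]_n.
Proof.
apply: normed_cvg; apply: (@series_le_cvg _ _
  (fun n => normE (f n) ^+ 2 + normE (g n) ^+ 2)) => [n|n|n|].
- exact: normr_ge0.
- by rewrite addr_ge0 ?sqr_ge0.
- exact: sform_le.
- exact: is_cvg_seriesD (H2_cvg f) (H2_cvg g).
Qed.

Lemma H2_sformC s f g : H2_sform s f g = H2_sform s g f.
Proof. by congr (limn (series _)); apply/funext => n; exact: sformC. Qed.

Lemma H2_sform_lin s r f g h :
  H2_sform s h (r *: f + g) = r * H2_sform s h f + H2_sform s h g.
Proof.
have hf := cvg_sform s h f; have hg := cvg_sform s h g.
rewrite /H2_sform -[r * limn _](lim_seriesZ r hf).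
rewrite -lim_seriesD //; last exact: is_cvg_seriesZ.
by congr (limn (series _)); apply/funext => n; exact: sform_lin.
Qed.

Lemma H2_sform_bilinear s : symmetric_bilinear (H2_sform s).
Proof.
split; last exact: H2_sformC.
split=> [h|h] r f g /=; last exact: H2_sform_lin.
by rewrite ![H2_sform s _ h]H2_sformC H2_sform_lin.
Qed.

(** Lets the negative summand of a Krein decomposition be treated as a positive one for the
    complementary pattern. *)
Lemma H2_sformN s f g : - H2_sform s f g = H2_sform (predC s) f g.
Proof.
rewrite /H2_sform -lim_seriesN; last exact: cvg_sform.
by congr (limn (series _)); apply/funext => n; rewrite /= -sformN.
Qed.

Lemma vanishing_on_submod s : submod_closed (vanishing_on s).
Proof.
split=> [|r f g /asboolP f0 /asboolP g0]; apply/asboolP => n i si.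
  by rewrite H2_zeroE Ht_coord0.
by rewrite H2_linE Ht_coord_lin f0 // g0 // mulr0 addr0.
Qed.

Lemma H2_sform_vanishing s f : f \in vanishing_on s ->
  H2_sform s f f = 2 * H2_sqnorm f.
Proof.
move=> /asboolP f0; rewrite /H2_sqnorm -[RHS](lim_seriesZ 2 (H2_cvg f)).
congr (limn (series _)); apply/funext => n.
rewrite [RHS](_ : _ = 2 * normE (f n) ^+ 2) // normE_coord mulr_sumr.
apply: eq_bigr => i _.
by have := f0 n i; case: (s i) => [->|_] //; rewrite ?(mulr0, expr0n) //=; ring.
Qed.

(** If the sum were nonpositive, every nonnegative term would vanish; as [t != 0] makes all weights
    positive, every coordinate would be zero. *)
Lemma H2_sqnorm_gt0 f : t != 0 -> f != 0 -> 0 < H2_sqnorm f.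
Proof.
move=> t0; apply: contra_neqT; rewrite -leNgt => f_le0.
apply: H2_eqP => n; apply: Ht_coord_inj => i; rewrite H2_zeroE Ht_coord0.
have := le_trans (normE_le_sqnorm f n) f_le0.
rewrite normE_coord => le0; apply/eqP; rewrite -sqrf_eq0.
have wsq j : 0 <= weight (t := t) j * Ht_coord j (f n) ^+ 2.
  by rewrite mulr_ge0 ?weight_ge0 ?sqr_ge0.
have /eqP : \sum_j weight (t := t) j * Ht_coord j (f n) ^+ 2 = 0.
  by apply/le_anti; rewrite le0 sumr_ge0.
rewrite psumr_eq0 // => /allP/(_ i (mem_index_enum i)).
by rewrite mulf_eq0 gt_eqF ?weight_gt0.
Qed.

(** * Completeness by coordinatewise limits *)

Lemma coord_sqr_le i f n :
  weight (t := t) i * Ht_coord i (f n) ^+ 2 <= H2_sqnorm f.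
Proof.
apply: le_trans (normE_le_sqnorm f n); rewrite normE_coord (bigD1 i) //= lerDl.
by apply: sumr_ge0 => j _; rewrite mulr_ge0 ?weight_ge0 ?sqr_ge0.
Qed.

Lemma H2_coord_complete (u : nat -> H2 t) : t != 0 ->
  (forall e, 0 < e -> exists N, forall m n, (N <= m)%N -> (N <= n)%N ->
     H2_sqnorm (u m - u n) < e) ->
  forall i k, cvgn (fun m => Ht_coord i (u m k)).
Proof.
move=> t0 u_cauchy i k; apply/cauchy_cvgP/cauchy_exP => e e0.
(* This tolerance becomes [e] after cancelling the weight and taking a square root. *)
have [|N uN] := u_cauchy (weight (t := t) i * e ^+ 2).
  by rewrite mulr_gt0 ?weight_gt0 ?exprn_gt0.
exists (Ht_coord i (u N k)); exists N => // m /= Nm.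
rewrite -ball_normE /= -Ht_coordB -H2_subE.
have := le_lt_trans (coord_sqr_le i _ k) (uN N m (leqnn N) Nm).
rewrite ltr_pM2l ?weight_gt0 // -(real_normK (num_real _)).
by rewrite ltr_pXn2r // ?nnegrE ?normr_ge0 // ltW.
Qed.

Lemma H2_complete (u : nat -> H2 t) : t != 0 ->
  (forall e, 0 < e -> exists N, forall m n, (N <= m)%N -> (N <= n)%N ->
     H2_sqnorm (u m - u n) < e) ->
  exists2 l : H2 t,
    (forall i k, Ht_coord i (u m k) @[m --> \oo] --> Ht_coord i (l k)) &
    H2_sqnorm (u m - l) @[m --> \oo] --> (0 : R).
Proof.
move=> t0 u_cauchy; have ucvg := H2_coord_complete u t0 u_cauchy.
pose l k : Ht t := Ht_of_coord (fun i => limn (fun m => Ht_coord i (u m k))).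
have lcvg i k : Ht_coord i (u m k) @[m --> \oo] --> Ht_coord i (l k).
  by rewrite Ht_of_coordK; exact: ucvg.
(* A Fatou-type bound: a partial sum is finite, so [m] can tend to infinity inside it, and the
   resulting bound is uniform in [K]. *)
have ul_le e : 0 < e -> exists N, forall n, (N <= n)%N -> forall K,
    [series normE (u n k - l k) ^+ 2]_k K <= e.
  move=> /u_cauchy[N uN]; exists N => n Nn K.
  have cvgK : [series normE (u n k - u m k) ^+ 2]_k K @[m --> \oo] -->
              [series normE (u n k - l k) ^+ 2]_k K.
    rewrite seriesEord /=; under eq_fun do rewrite seriesEord /=.
    apply: cvg_big => [|k _]; first exact: add_continuous.
     rewrite normE_coord.
    under eq_fun do rewrite normE_coord.
    apply: cvg_big => [|i _]; first exact: add_continuous.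
     apply: cvgMl_tmp.
    rewrite Ht_coordB; under eq_fun do rewrite Ht_coordB.
    by rewrite !expr2; apply: cvgM; apply: cvgB (lcvg i k); exact: cvg_cst.
  apply: (cvgr_to_le cvgK); exists N => // m Nm.
  apply/ltW; apply: le_lt_trans (uN n m Nn Nm).
  exact: series_le_sqnorm (u n - u m) K.
have lP : l \in @H2_pred R t.
  have [N /(_ N (leqnn N)) ulN] := ul_le 1 ltr01.
  (* The limit differs from a member of the space by a sequence whose partial sums are at most 1. *)
  have -> : l = H2_coef (u N) - (fun k => u N k - l k).
    by apply/funext => k; rewrite /= !fctE opprB addrC subrK.
  by apply: rpredB; [exact: H2_coefP | exact: bounded_series_H2 ulN].
exists (H2Sub lP) => //; apply/cvgr0Pnorm_le => e e0.
have [N ulN] := ul_le e e0; exists N => // m Nm.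
rewrite ger0_norm ?H2_sqnorm_ge0 //.
by apply: limr_le; [exact: H2_cvg | exists 0%N => // K _; exact: ulN].
Qed.

Lemma hilbert_vanishing s : t != 0 -> hilbert_on (H2_sform s) (vanishing_on s).
Proof.
move=> t0; split.
- exact: vanishing_on_submod.
- exact: H2_sform_bilinear.
- by move=> f fs f0; rewrite H2_sform_vanishing // mulr_gt0 ?H2_sqnorm_gt0.
move=> u us u_cauchy.
(* The subspace is closed under differences, so on them the form is twice the squared norm. *)
have form_normE m n : form_norm (H2_sform s) (u m - u n) =
    Num.sqrt (2 * H2_sqnorm (u m - u n)).
  rewrite /form_norm H2_sform_vanishing //.
  have [_] := vanishing_on_submod s => /(_ (-1) _ _ (us n) (us m)).
  by rewrite scaleN1r addrC.
have [e e0|l ul ul0] := H2_complete u t0.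
  (* A form norm below this value means a squared norm below [e]. *)
  have [|N uN] := u_cauchy (Num.sqrt (2 * e)).
     by rewrite sqrtr_gt0 mulr_gt0.
  exists N => m n Nm Nn; have := uN m n Nm Nn.
  by rewrite form_normE ltr_sqrt ?mulr_gt0 // ltr_pM2l.
(* A coordinate that is zero along the whole sequence has limit zero. *)
have ls : l \in vanishing_on s.
  apply/asboolP => k i si; apply: (cvg_unique _ (ul i k)) => //.
  rewrite (_ : (fun m => _) = cst 0); first exact: cvg_cst.
  by apply/funext => m; have /asboolP := us m; exact.
exists l => //.
have -> : (fun n => form_norm (H2_sform s) (u n - l)) =
    (fun n => Num.sqrt (2 * H2_sqnorm (u n - l))).
  apply/funext => n; rewrite /form_norm H2_sform_vanishing //.
  have [_] := vanishing_on_submod s => /(_ (-1) _ _ ls (us n)).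
  by rewrite scaleN1r addrC.
rewrite -(sqrtr0 R) -(mulr0 2).
apply: (continuous_cvg _ (@sqrt_continuous R _)).
by apply: cvgMl_tmp.
Qed.

(** * The fundamental decomposition *)

Definition Ht_restrict s (q : Ht t) : Ht t :=
  Ht_of_coord (fun i => if s i then Ht_coord i q else 0).

(** Zeroing coordinates can only decrease the partial sums of the squared norm. *)
Lemma Ht_restrict_H2 s f : (fun n => Ht_restrict s (f n)) \in @H2_pred R t.
Proof.
apply: (bounded_series_H2 _ (H2_sqnorm f)) => n.
apply: le_trans (series_le_sqnorm f n).
rewrite !seriesEord /=; apply: ler_sum => k _; rewrite !normE_coord.
apply: ler_sum => i _; rewrite Ht_of_coordK; case: (s i) => //.
by rewrite expr0n mulr0 mulr_ge0 ?weight_ge0 ?sqr_ge0.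
Qed.

Lemma krein_sform s : t != 0 -> krein_space (H2_sform s).
Proof.
move=> t0; split; first exact: H2_sform_bilinear.
exists (vanishing_on s), (vanishing_on (predC s)); split.
(* The masks are swapped: keeping the coordinates outside [s] gives the summand that vanishes on
   [s]. *)
- move=> f; exists (H2Sub (Ht_restrict_H2 (predC s) f)).
  exists (H2Sub (Ht_restrict_H2 s f)); split.
  + by apply/asboolP => n i si; rewrite /= Ht_of_coordK /= si.
  + by apply/asboolP => n i /negbTE si; rewrite /= Ht_of_coordK /= si.
  apply: H2_eqP => n; apply: Ht_coord_inj => i.
  rewrite -[X in X + _]scale1r H2_linE Ht_coord_lin !Ht_of_coordK /= mul1r.
  by case: (s i); rewrite ?addr0 ?add0r.
- move=> f /asboolP fs /asboolP fCs.
  apply: H2_eqP => n; apply: Ht_coord_inj => i.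
  rewrite H2_zeroE Ht_coord0; case: (boolP (s i)); first exact: fs.
  exact: fCs.
- move=> f g /asboolP fs /asboolP gCs; rewrite /H2_sform.
  have -> : [series sform s (f n) (g n)]_n = cst 0; last exact: lim_cst.
  (* In each coordinate one of the two factors is zero. *)
  apply/funext => n; rewrite /series /= big1 // => k _; apply: big1 => i _.
  case: (boolP (s i)) => si.
    by rewrite fs // mul0r mulr0.
  by rewrite (gCs k i) // !mulr0.
- exact: hilbert_vanishing.
- have -> : (fun f g => - H2_sform s f g) = H2_sform (predC s).
    by apply/funext => f; apply/funext => g; exact: H2_sformN.
  exact: hilbert_vanishing.
Qed.

(** * The two forms of the theorem as instances of [H2_sform] *)

Lemma H2_form_circE : H2_form_circ (t := t) =
  H2_sform (fun i => (0 < t) && (1 < i)%N).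
Proof.
(* Symmetry is needed because [H2_form_circ] pairs [g n] with [f n] in that order. *)
apply/funext => f; apply/funext => g; rewrite H2_sformC.
by congr (limn (series _)); apply/funext => n; exact: form_circE.
Qed.

Lemma H2_form_starE : H2_form_star (t := t) =
  H2_sform (fun i => (val i == 1)%N || (val i == if 0 < t then 3 else 2)).
Proof.
apply/funext => f; apply/funext => g; rewrite H2_sformC.
by congr (limn (series _)); apply/funext => n; exact: form_starE.
Qed.

End HardySpace.

Theorem theorem4p2 (R : realType) (t : R) (ht : t != 0) :
  [/\ (forall f g : H2 t,
         cvgn [series form_circ (g n) (f n)]_n /\
         cvgn [series form_star (g n) (f n)]_n),
      krein_space (@H2_form_circ R t),
      krein_space (@H2_form_star R t) &
      (t < 0 -> hilbert_space (@H2_form_circ R t))].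
Proof.
rewrite H2_form_circE H2_form_starE; split=> [f g|||t_lt0].
- split; under eq_fun do rewrite ?form_circE ?form_starE; exact: cvg_sform.
- exact: krein_sform.
- exact: krein_sform.
rewrite /hilbert_space; set s := (fun i => _).
(* For [t < 0] the pattern is empty, so the positive summand is the whole space. *)
have -> : (predT : {pred H2 t}) = vanishing_on s; last exact: hilbert_vanishing.
apply/funext => f; apply/esym/asboolP => n i.
by rewrite /s ltNge (ltW t_lt0).
Qed.
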